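(* Let $n\ge 1$ and let $S=(s_i)$ be an orientable sequence of order $n$ and period $m$. Then: (i) if $w(S)$ is even, $D^{-1}(S)$ consists of an o-disjoint pair of primitive, mutually complementary orientable sequences of order $n+1$, each of period $m$; (ii) if $w(S)$ is odd, $D^{-1}(S)$ consists of two different shifts of a single orientable sequence of order $n+1$, of period $2m$ and weight $m$.
   Context: A periodic binary sequence $S=(s_i)$, $s_i\in\{0,1\}$, has period $m$ = least $m>0$ with $s_{i+m}=s_i$ for all $i$. For $n>0$, $\mathbf{s}_n(i)=(s_i,\dots,s_{i+n-1})$ is the $n$-tuple at position $i$. The weight is $w(S)=\sum_{i=0}^{m-1}s_i$. The reverse of a tuple $(u_0,\dots,u_{n-1})$ is $(u_{n-1},\dots,u_0)$, written $\mathbf{u}^R$. The complement of a tuple/sequence swaps every $0$ and $1$. An $n$-window sequence is a periodic binary sequence of period $m$ such that $\mathbf{s}_n(i)=\mathbf{s}_n(j)$ implies $i\equiv j \pmod m$. An orientable sequence of order $n$ is an $n$-window sequence with $\mathbf{s}_n(i)\neq \mathbf{s}_n(j)^R$ for all $i,j$. Two $n$-window sequences $S,T$ are disjoint if $\mathbf{s}_n(i)\ne\mathbf{t}_n(j)$ for all $i,j$; a pair of disjoint orientable sequences $S,S'$ of order $n$ is o-disjoint if additionally $\mathbf{s}_n(i)\neq \mathbf{s}'_n(j)^R$ for all $i,j$. An $n$-window sequence is primitive if it is disjoint from its complement. The Lempel map $D$ sends a periodic binary sequence $T=(t_i)$ to $D(T)=(t_i\oplus t_{i+1})$ ($\oplus$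 = addition mod 2); $D^{-1}(S)$ is the set of all periodic binary sequences $T$ with $D(T)=S$. *)

(* Defs.v *)
From mathcomp Require Import all_boot.
From mathcomp Require Import classical_sets.

Set Implicit Arguments.
Unset Strict Implicit.
Unset Printing Implicit Defensive.

(* Positions range over nat: a (purely) periodic sequence is determined by its
   terms at nonnegative positions, so nothing is lost with respect to Z. *)
Definition binseq := nat -> bool.

Definition is_period (S : binseq) (m : nat) : Prop :=
  [/\ 0 < m, forall i, S (i + m) = S i
    & forall p, 0 < p -> (forall i, S (i + p) = S i) -> m <= p].

Definition periodic (S : binseq) : Prop := exists m, is_period S m.

Definition window (n : nat) (S : binseq) (i : nat) : n.-tuple bool :=
  [tuple S (i + k) | k < n].

(* The weight of S when m is its period. *)
Definition weight (m : nat) (S : binseq) : nat := \sum_(i < m) S i.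

Definition complement (S : binseq) : binseq := fun i => ~~ S i.

Definition shift (a : nat) (S : binseq) : binseq := fun i => S (i + a).

Definition window_seq (n : nat) (S : binseq) : Prop :=
  exists2 m, is_period S m
    & forall i j, window n S i = window n S j -> i = j %[mod m].

Definition orientable (n : nat) (S : binseq) : Prop :=
  window_seq n S /\
  forall i j, window n S i <> rev_tuple (window n S j).

Definition disjoint_seqs (n : nat) (S T : binseq) : Prop :=
  [/\ window_seq n S, window_seq n T
    & forall i j, window n S i <> window n T j].

Definition o_disjoint (n : nat) (S T : binseq) : Prop :=
  [/\ orientable n S, orientable n T, disjoint_seqs n S T
    & forall i j, window n S i <> rev_tuple (window n T j)].

Definition primitive (n : nat) (S : binseq) : Prop :=
  window_seq n S /\ disjoint_seqs n S (complement S).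

Definition lempel (T : binseq) : binseq := fun i => T i (+) T i.+1.

Definition lempel_inv (S : binseq) : set binseq :=
  [set T | periodic T /\ lempel T = S]%classic.

(* Main.v *)
(** If [lempel T = S], then [T] is determined by [S] and one of its terms, and
    an [n.+1]-window of [T], or its reverse, maps under [lempel] to the
    corresponding [n]-window of [S], or its reverse.  Hence a coincidence
    between windows of [T] descends to [S]: reversed coincidences are excluded,
    and the others force [i = j %[mod m]].  Moreover [T (i + q * m)] differs
    from [T i] exactly when [q] and [w(S)] are both odd, which fixes the period
    of [T] and decides whether [complement T] is a shift of [T]. *)
Require Import Defs.
From mathcomp Require Import all_boot.
From mathcomp Require Import boolp classical_sets.

Lemma windowP n S T i j :
  window n S i = window n T j <-> forall k, k < n -> S (i + k) = T (j + k).
Proof.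
split=> [eqST k ltkn|eqST].
  have := congr1 (fun t => tnth t (Ordinal ltkn)) eqST.
  by rewrite !tnth_mktuple.
by apply: eq_from_tnth => k; rewrite !tnth_mktuple; apply: eqST.
Qed.

Lemma window_revP n S T i j :
  window n S i = rev_tuple (window n T j) <->
  forall k, k < n -> S (i + k) = T (j + (n - k.+1)).
Proof.
have tnth_rev (k : 'I_n) :
    tnth (rev_tuple (window n T j)) k = T (j + (n - k.+1)).
  rewrite -[RHS](tnth_mktuple (fun l : 'I_n => T (j + l)) (rev_ord k)).
  by rewrite !(tnth_nth false) [LHS]nth_rev size_tuple.
split=> [eqST k ltkn|eqST].
  have := congr1 (fun t => tnth t (Ordinal ltkn)) eqST.
  by rewrite tnth_mktuple tnth_rev.
by apply: eq_from_tnth => k; rewrite tnth_mktuple tnth_rev; apply: eqST.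
Qed.

Lemma is_period_uniq S p q : is_period S p -> is_period S q -> p = q.
Proof.
case=> p_gt0 Sp p_min [q_gt0 Sq q_min].
by apply/eqP; rewrite eqn_leq p_min // q_min.
Qed.

(** [window_seq] hides its modulus behind an existential; uniqueness of the least period identifies
    it with [m]. *)
Lemma window_seq_modn n S m i j :
  window_seq n S -> is_period S m -> window n S i = window n S j ->
  i = j %[mod m].
Proof. by case=> m' Sm' inj /(is_period_uniq _ _ _ Sm') <-; apply: inj. Qed.

Lemma lempel_window n T U i j :
  window n.+1 T i = window n.+1 U j ->
  window n (lempel T) i = window n (lempel U) j.
Proof.
move/windowP=> eqTU; apply/windowP=> k ltkn.
by rewrite /lempel -!addnS !eqTU // ltnS ltnW.
Qed.

(** Reversal swaps the two terms of each adjacent pair, which their sum mod 2 does not notice. *)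
Lemma lempel_window_rev n T U i j :
  window n.+1 T i = rev_tuple (window n.+1 U j) ->
  window n (lempel T) i = rev_tuple (window n (lempel U) j).
Proof.
move/window_revP=> eqTU; apply/window_revP=> k ltkn.
rewrite /lempel -!addnS !eqTU //; last by rewrite ltnS ltnW.
by rewrite !subSS -subSn // subSS addbC.
Qed.

Lemma window_head n T U i j :
  window n.+1 T i = window n.+1 U j -> T i = U j.
Proof. by move/windowP/(_ 0 isT); rewrite !addn0. Qed.

Lemma complementK : involutive complement.
Proof. by move=> T; apply/funext=> i; apply: negbK. Qed.

Lemma lempel_complement T : lempel (complement T) = lempel T.
Proof. by apply/funext=> i; rewrite /lempel /complement addbN addNb negbK. Qed.

(** The sum telescopes mod 2. *)
Lemma lempel_sum T i k :
  T (i + k) = T i (+) odd (\sum_(j < k) lempel T (i + j)).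
Proof.
elim: k => [|k IHk]; first by rewrite big_ord0 addn0 addbF.
rewrite big_ord_recr oddD addbA -IHk /= oddb /lempel addbA addbb.
by rewrite addFb addnS.
Qed.

Lemma lempel_inj T U : lempel T = lempel U -> T 0 = U 0 -> T = U.
Proof.
move=> eqD eq0; apply/funext=> i.
by rewrite -[i]add0n !lempel_sum eqD eq0.
Qed.

(** Partial sums mod 2: the preimage whose first term is [false]. *)
Definition lempel_preimage (S : binseq) : binseq :=
  fun i => odd (\sum_(j < i) S j).

Lemma lempel_preimageK S : lempel (lempel_preimage S) = S.
Proof.
apply/funext=> i; rewrite /lempel /lempel_preimage big_ord_recr oddD.
by rewrite addbA addbb oddb.
Qed.

Lemma lempel_addn T p :
  (forall i, T (i + p) = T i) -> forall i, lempel T (i + p) = lempel T i.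
Proof. by move=> Tp i; rewrite /lempel -addSn !Tp. Qed.

Section LempelPreimage.

Variables (n m : nat) (T : binseq).
Hypotheses (DT_orientable : orientable n (lempel T))
  (DT_period : is_period (lempel T) m).

Local Notation w := (weight m (lempel T)).

Let m_gt0 : 0 < m. Proof. by case: DT_period. Qed.

(** Telescoping over one period settles position 0; the offset then propagates, since [T] and its
    shift by [m] have the same differences. *)
Lemma lempel_shift_period i : T (i + m) = T i (+) odd w.
Proof.
case: DT_period => _ DTm _.
elim: i => [|i IHi]; first by rewrite lempel_sum.
have := DTm i; rewrite /lempel IHi -addSn.
by case: (T i) (T i.+1) (T (i.+1 + m)) (odd w) => [] [] [] [].
Qed.

Lemma lempel_shift_muln i q : T (i + q * m) = T i (+) (odd q && odd w).
Proof.
elim: q => [|q IHq]; first by rewrite mul0n addn0 addbF.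
rewrite mulSn addnCA addnC lempel_shift_period IHq /=.
by case: (T i) (odd q) (odd w) => [] [] [].
Qed.

(** A second preimage [U] is allowed so that [U = T] serves orientability and [U = complement T]
    serves o-disjointness. *)
Lemma window_rev_neq U i j :
  lempel U = lempel T -> window n.+1 T i <> rev_tuple (window n.+1 U j).
Proof.
case: DT_orientable => _ DTrev DU /lempel_window_rev; rewrite DU.
exact: DTrev.
Qed.

Lemma window_modn U i j :
  lempel U = lempel T -> window n.+1 T i = window n.+1 U j -> i = j %[mod m].
Proof.
case: DT_orientable => DTwin _ DU /lempel_window; rewrite DU.
exact: window_seq_modn.
Qed.

Section Even.

Hypothesis w_even : ~~ odd w.

Lemma even_preimage_period : is_period T m.
Proof.
split=> // [i|p p_gt0 Tp].
  by rewrite lempel_shift_period (negbTE w_even) addbF.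
by case: DT_period => _ _; apply=> //; apply: lempel_addn.
Qed.

Lemma even_preimage_orientable : orientable n.+1 T.
Proof.
split=> [|i j]; last exact: window_rev_neq.
exists m => [|i j]; [exact: even_preimage_period | exact: window_modn].
Qed.

(** Equal windows would force [i = j %[mod m]], hence [T i = T j] as [m] is a period of [T], whereas
    the first terms give [T i = ~~ T j]. *)
Lemma even_preimage_complement_neq i j :
  window n.+1 T i <> window n.+1 (complement T) j.
Proof.
move=> eqw; have eqij := window_modn _ _ _ (lempel_complement T) eqw.
have Tmod k : T k = T (k %% m).
  rewrite {1}(divn_eq k m) addnC lempel_shift_muln (negbTE w_even).
  by rewrite andbF addbF.
move: (window_head _ _ _ _ _ eqw); rewrite /complement Tmod eqij -Tmod.
by case: (T j).
Qed.

End Even.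

Section Odd.

Hypothesis w_odd : odd w.

Lemma odd_preimage_dvdn i q : T (i + q * m) = T i -> 2 * m %| q * m.
Proof.
rewrite lempel_shift_muln w_odd andbT => eqT.
by rewrite dvdn_pmul2r // dvdn2; case: (T i) (odd q) eqT => [] [].
Qed.

(** Descending to [lempel T] only yields a congruence modulo [m]; agreement of the first terms then
    makes the quotient [q] of the distance by [m] even. *)
Lemma odd_preimage_modn i j : window n.+1 T i = window n.+1 T j ->
  i = j %[mod 2 * m].
Proof.
wlog leij : i j / i <= j => [hw eqw|eqw].
  by case/orP: (leq_total i j) => /hw h; [|symmetry]; apply: h.
have /eqP := window_modn _ _ _ erefl eqw.
rewrite eq_sym eqn_mod_dvd // => /dvdnP[q defq].
apply/eqP; rewrite eq_sym eqn_mod_dvd // defq.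
apply: (odd_preimage_dvdn i).
by rewrite -defq subnKC // (window_head _ _ _ _ _ eqw).
Qed.

Lemma odd_preimage_period : is_period T (2 * m).
Proof.
split=> [|i|p p_gt0 Tp]; first by rewrite muln_gt0.
  by rewrite lempel_shift_muln addbF.
(* A period [p] makes the windows at [p] and 0 equal, so [2 * m] divides [p]. *)
apply: dvdn_leq => //; rewrite -[p]subn0 -eqn_mod_dvd //.
apply/eqP/odd_preimage_modn/windowP => k _.
by rewrite addnC Tp.
Qed.

Lemma odd_preimage_orientable : orientable n.+1 T.
Proof.
split=> [|i j]; last exact: window_rev_neq.
exists (2 * m) => [|i j].
  exact: odd_preimage_period.
exact: odd_preimage_modn.
Qed.

Lemma odd_preimage_shift : shift m T = complement T.
Proof.
apply/funext=> i.
by rewrite /shift /complement lempel_shift_period w_odd addbT.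
Qed.

(* Each term in the first half-period is complementary to the one [m] later. *)
Lemma odd_preimage_weight : weight (2 * m) T = m.
Proof.
rewrite /weight mul2n -addnn big_split_ord /= -big_split /=.
rewrite -[RHS](card_ord m) -sum1_card; apply: eq_bigr => i _.
by rewrite addnC [m + i]addnC lempel_shift_period w_odd addbT; case: (T i).
Qed.

End Odd.

(** The first term determines a preimage, and [T] and [complement T] realise both choices. *)
Lemma lempel_inv_pair : periodic T -> periodic (complement T) ->
  lempel_inv (lempel T) = [set T; complement T]%classic.
Proof.
move=> pT pcT; apply/seteqP; split=> [U [_ DU]|U [] ->] /=; last 2 first.
- by split.
- by split=> //; apply: lempel_complement.
have [eq0|neq0] := eqVneq (U 0) (T 0); first by left; apply: lempel_inj.
right; apply: lempel_inj; first by rewrite lempel_complement.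
by rewrite /complement; case: (U 0) (T 0) neq0 => [] [].
Qed.

End LempelPreimage.

Theorem theorem4 (n m : nat) (S : binseq) (n_ge1 : 1 <= n)
    (S_orientable : orientable n S) (S_period : is_period S m) :
  (~~ odd (weight m S) ->
     exists T T' : binseq,
       [/\ lempel_inv S = [set T; T']%classic,
           o_disjoint n.+1 T T',
           T' = complement T,
           [/\ orientable n.+1 T, primitive n.+1 T & is_period T m]
         & [/\ orientable n.+1 T', primitive n.+1 T' & is_period T' m]]) /\
  (odd (weight m S) ->
     exists (T : binseq) (a b : nat),
       [/\ lempel_inv S = [set shift a T; shift b T]%classic,
           shift a T <> shift b T,
           orientable n.+1 T,
           is_period T (2 * m)
         & weight (2 * m) T = m]).
Proof.
set T := lempel_preimage S; have DT : lempel T = S := lempel_preimageK S.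
have DT' : lempel (complement T) = S by rewrite lempel_complement.
split=> [w_even|w_odd].
  (* Stated for an arbitrary preimage, to be applied to both [T] and its complement. *)
  have evenP U : lempel U = S ->
      [/\ orientable n.+1 U, is_period U m
        & forall i j, window n.+1 U i <> window n.+1 (complement U) j].
    move=> DU; rewrite -DU in S_orientable S_period w_even.
    split.
    - exact: (even_preimage_orientable _ _ _ S_orientable S_period w_even).
    - exact: (even_preimage_period _ _ S_period w_even).
    exact: (even_preimage_complement_neq _ _ _ S_orientable S_period).
  have [oT pT dT] := evenP T DT; have [oT' pT' dT'] := evenP _ DT'.
  have [[wT _] [wT' _]] := (oT, oT').
  exists T, (complement T); split=> //.
  - by rewrite -[in LHS]DT; apply: lempel_inv_pair; exists m.
  - split=> // i j; apply: window_rev_neq; last by rewrite DT' DT.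
    by rewrite DT.
  - by rewrite complementK in dT'; rewrite /primitive complementK.
rewrite -DT in S_orientable S_period w_odd.
have shT := odd_preimage_shift _ _ S_period w_odd.
have sh0 : shift 0 T = T by apply/funext=> i; rewrite /shift addn0.
have pT := odd_preimage_period _ _ _ S_orientable S_period w_odd.
(* Shifting by [m] complements [T], so the shifts by 0 and [m] are the two preimages. *)
exists T, 0, m; rewrite sh0 shT; split=> //.
- rewrite -[in LHS]DT; apply: lempel_inv_pair; first by exists (2 * m).
  (* Viewing [S] as the image of [complement T] makes the period lemma apply to the complement. *)
  exists (2 * m); rewrite -lempel_complement in S_orientable S_period w_odd.
  exact: (odd_preimage_period _ _ _ S_orientable S_period w_odd).
- by move/(congr1 (@^~ 0)); rewrite /complement; case: (T 0).
- exact: (odd_preimage_orientable _ _ _ S_orientable S_period w_odd).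
- exact: (odd_preimage_weight _ _ S_period w_odd).
Qed.
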